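(* Let $(X,d)$ be a complete regular semimetric space with an upper semicontinuous triangle function $\Phi\colon\mathbb{R}_+^2\to\mathbb{R}_+$ for $d$ and let $\varphi:\mathbb{R}_+\to\mathbb{R}_+$ be an upper semicontinuous comparison function. Let $(T_{k,1})_{k\in\mathbb{N}},\dots,(T_{k,n})_{k\in\mathbb{N}}$ be sequences of $\varphi$-contractions $X\to X$ that converge pointwise to some $\varphi$-contractions $T_{0,1},\dots,T_{0,n}\colon X\to X$, respectively. For $k\in\mathbb{N}\cup\{0\}$, define the mapping $\mathbb{T}_k\colon\mathscr{K}(X)\to\mathscr{K}(X)$ by $$\mathbb{T}_k(H)=\bigcup_{j=1}^nT_{k,j}(H)$$ and denote by $H_k$ the unique fractal in $\mathscr{K}(X)$ with respect to the system $(T_{k,1},\ldots,T_{k,n})$ (i.e., the unique $H_k\in\mathscr{K}(X)$ with $\mathbb{T}_k(H_k)=H_k$). Then the sequence $(H_k)$ converges to $H_0$ with respect to the semimetric $D$, i.e., $D(H_k,H_0)\to0$ as $k\to\infty$.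
   Context: $\mathbb{R}_+=[0,\infty)$. A semimetric space $(X,d)$ is a nonempty set $X$ with a symmetric function $d:X\times X\to\mathbb{R}_+$ such that $d(x,y)=0$ if and only if $x=y$ (no triangle inequality is assumed). A triangle function for $d$ is a symmetric function $\Phi:\mathbb{R}_+^2\to[0,\infty]$, monotone increasing (in the weak sense) in both arguments, with $\Phi(0,0)=0$ and $d(x,y)\le\Phi(d(x,z),d(z,y))$ for all $x,y,z\in X$; here $\Phi$ is assumed to be finite-valued. The space is regular if it admits some triangle function that is continuous at $(0,0)$. A sequence $(x_n)$ converges to $x$ if $d(x_n,x)\to0$; it is Cauchy if for every $\varepsilon>0$ there is $n_0$ with $d(x_n,x_m)<\varepsilon$ for $n,m\ge n_0$; the space is complete if every Cauchy sequence converges. Pointwise convergence $T_{k,j}\to T_{0,j}$ means $d(T_{k,j}(x),T_{0,j}(x))\to0$ as $k\to\infty$ for every $x\in X$. For $p\in X$ and $r\in(0,\infty]$, the ball is $\mathscr{B}(p,r)=\{x\in X: d(x,p)<r\}$. A set $A\subseteq X$ is open if for every $p\in A$ there is $r>0$ with $\mathscr{B}(p,r)\subseteq A$; the open sets form a topology on $X$ (balls need not be open). A set is compact if each of its covers by open sets has a finite subcover; $\mathscr{K}(X)$ is the family of all nonempty compact subsets of $X$. For nonempty $A,B\subseteq X$ the Hausdorff--Pompeiu distance is $$D(A,B)=\inf\Bigl\{\varepsilon\in(0,\infty]\ \Big|\ A\subseteq\bigcup_{b\in B}\mathscr{B}(b,\varepsilon),\ B\subseteq\bigcup_{a\in A}\mathscr{B}(a,\varepsilon)\Bigr\}.$$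 A comparison function is a map $\varphi:\mathbb{R}_+\to\mathbb{R}_+$ that is increasing ($s\le t$ implies $\varphi(s)\le\varphi(t)$) and satisfies $\lim_{m\to\infty}\varphi^m(t)=0$ for all $t>0$, where $\varphi^m$ is the $m$-th iterate. A map $S:X\to X$ is a $\varphi$-contraction if $d(S(x),S(y))\le\varphi(d(x,y))$ for all $x,y\in X$. A fractal with respect to a system $(S_1,\dots,S_n)$ of self-maps of $X$ is a nonempty set $F\subseteq X$ with $F=\bigcup_{j=1}^nS_j(F)$; under the hypotheses each system $(T_{k,1},\dots,T_{k,n})$ has exactly one fractal in $\mathscr{K}(X)$. *)

(* Defs.v *)
From HB Require Import structures.
From mathcomp Require Import all_boot all_order all_algebra.
From mathcomp Require Import all_classical all_reals all_analysis.
Import Order.TTheory GRing.Theory Num.Theory numFieldNormedType.Exports.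

Set Implicit Arguments.
Unset Strict Implicit.
Unset Printing Implicit Defensive.

Local Open Scope classical_set_scope.
Local Open Scope ring_scope.

(* Functions defined on [0, +oo[ or on its square are represented by functions
   defined on R or R * R; every condition imposed on them below only concerns
   nonnegative arguments. *)

Definition upper_semicontinuous_on (R : realType) (T : topologicalType)
    (A : set T) (f : T -> R) : Prop :=
  forall x, A x -> forall a, f x < a ->
    \forall y \near within A (nbhs x), f y < a.

Definition nonneg_line (R : realType) : set R := [set t | 0 <= t].

Definition nonneg_quadrant (R : realType) : set (R * R) :=
  [set p | 0 <= p.1 /\ 0 <= p.2].

Record is_semimetric (R : realType) (X : Type) (d : X -> X -> R) : Prop := {
  semimetric_nonempty : [set: X] !=set0 ;
  semimetric_ge0 : forall x y, 0 <= d x y ;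
  semimetric_sym : forall x y, d x y = d y x ;
  semimetric_eq0 : forall x y, d x y = 0 <-> x = y
}.

Section Semimetric.
Context {R : realType} {X : Type}.
Implicit Types (d : X -> X -> R) (A B : set X).

Local Open Scope ereal_scope.

Record triangle_function d (Phi : R * R -> \bar R) : Prop := {
  triangle_ge0 : forall s t : R, (0 <= s)%R -> (0 <= t)%R -> 0 <= Phi (s, t) ;
  triangle_sym : forall s t : R, (0 <= s)%R -> (0 <= t)%R ->
    Phi (s, t) = Phi (t, s) ;
  triangle_mono : forall s s' t t' : R, (0 <= s <= s')%R -> (0 <= t <= t')%R ->
    Phi (s, t) <= Phi (s', t') ;
  triangle_0 : Phi (0%R, 0%R) = 0 ;
  triangle_ineq : forall x y z, (d x y)%:E <= Phi (d x z, d z y)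
}.

Definition regular_semimetric d : Prop :=
  exists2 Phi, triangle_function d Phi &
    Phi p @[p --> within (@nonneg_quadrant R) (nbhs (0%R, 0%R))]
      --> Phi (0%R, 0%R).

Local Close Scope ereal_scope.

Definition cauchy_sequence d (x : nat -> X) : Prop :=
  forall e : R, 0 < e -> exists n0 : nat, forall n m : nat,
    (n0 <= n)%N -> (n0 <= m)%N -> d (x n) (x m) < e.

Definition complete_semimetric d : Prop :=
  forall x : nat -> X, cauchy_sequence d x ->
    exists l, d (x n) l @[n --> \oo] --> (0 : R).

(* The radius may be +oo, in which case the ball is the whole space. *)
Definition sball d (p : X) (r : \bar R) : set X := [set x | (d x p)%:E < r]%E.

Definition semimetric_open d A : Prop :=
  forall p, A p -> exists2 r : \bar R, (0 < r)%E & sball d p r `<=` A.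

(* Alias of X carrying the topology induced by d; balls need not be open. *)
Definition semimetric_space d : Type := X.

Section Topology.
Variable d : X -> X -> R.

Lemma semimetric_openT : semimetric_open d setT.
Proof. by move=> p _; exists +oo%E. Qed.

Lemma semimetric_openI : setI_closed (semimetric_open d).
Proof.
move=> A B oA oB p [/oA[r r0 rA] /oB[s s0 sB]].
exists (Order.min r s) => [|x]; first by rewrite lt_min r0.
by rewrite /sball/= lt_min => /andP[/rA ? /sB].
Qed.

Lemma semimetric_open_bigU (I : Type) (f : I -> set X) :
  (forall i, semimetric_open d (f i)) -> semimetric_open d (\bigcup_i f i).
Proof.
move=> of_ p [i _ /of_[r r0 rf]]; exists r => // x /rf; by exists i.
Qed.

HB.instance Definition _ := gen_eqMixin (semimetric_space d).
HB.instance Definition _ := gen_choiceMixin (semimetric_space d).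
HB.instance Definition _ := isOpenTopological.Build (semimetric_space d)
  semimetric_openT semimetric_openI semimetric_open_bigU.

Lemma semimetric_openE (A : set (semimetric_space d)) :
  open A <-> semimetric_open d A.
Proof. by []. Qed.

End Topology.

Definition compact_sets d : set (set X) :=
  [set A | A !=set0 /\ cover_compact (A : set (semimetric_space d))].

Definition hausdorff_pompeiu d A B : \bar R :=
  ereal_inf [set e : \bar R | (0 < e)%E /\
    A `<=` \bigcup_(b in B) sball d b e /\
    B `<=` \bigcup_(a in A) sball d a e].

Record comparison_function (phi : R -> R) : Prop := {
  comparison_ge0 : forall t : R, 0 <= t -> 0 <= phi t ;
  comparison_mono : forall s t : R, 0 <= s -> s <= t -> phi s <= phi t ;
  comparison_iter : forall t : R, 0 < t -> iter m phi t @[m --> \oo] --> (0 : R)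
}.

Definition phi_contraction d (phi : R -> R) (S : X -> X) : Prop :=
  forall x y, d (S x) (S y) <= phi (d x y).

Definition hutchinson (n : nat) (S : 'I_n -> X -> X) (H : set X) : set X :=
  \bigcup_(j in [set: 'I_n]) (S j @` H).

Definition fractal (n : nat) (S : 'I_n -> X -> X) (F : set X) : Prop :=
  F !=set0 /\ F = hutchinson S F.

End Semimetric.

(* Main.v *)
(* Compare the two fractals along words: [T_k^w] for a word [w] of length [m]
   is a [phi^m]-contraction, and [T_k^w -> T_0^w] uniformly on [H_0].  Fixing
   [m] with [phi^m 1] small, [T_k^w] maps the 1-neighbourhood of [H_0] into a
   small neighbourhood of [H_0] for all large [k], so a point of [H_0] never
   leaves that neighbourhood under [T_k^w] with [|w|] a multiple of [m].  Since every
   point of [H_k] is approximated by such orbits, [H_k] is close to [H_0]; in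
   particular the [H_k] are uniformly bounded.  Then every point of [H_0], of
   the form [T_0^w b], is close to [T_k^w b], which is close to [H_k] by
   contraction. *)

Require Import Defs.
From mathcomp Require Import all_boot all_order all_algebra finmap.
From mathcomp Require Import all_classical all_reals all_analysis.
Import Order.TTheory GRing.Theory Num.Theory numFieldNormedType.Exports.

Local Open Scope classical_set_scope.
Local Open Scope ring_scope.

Set Implicit Arguments.
Unset Strict Implicit.
Unset Printing Implicit Defensive.

(** * Iterates of a comparison function *)

Section Comparison.
Context {R : realType} {phi : R -> R}.
Context (phi_comparison : comparison_function phi).

Lemma iter_comparison_ge0 m t : 0 <= t -> 0 <= iter m phi t.
Proof. by move=> t0; elim: m => //= m; exact: comparison_ge0. Qed.

Lemma iter_comparison_mono m s t :
  0 <= s -> s <= t -> iter m phi s <= iter m phi t.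
Proof.
move=> s0 st; elim: m => //= m IHm.
by apply: comparison_mono => //; exact: iter_comparison_ge0.
Qed.

Lemma iter_comparison_small t e : 0 <= t -> 0 < e ->
  exists N, forall m, (N <= m)%N -> iter m phi t < e.
Proof.
(* Iterates are assumed to vanish only from positive starting points; starting at [t + 1] also
   covers [t = 0]. *)
move=> t0 e0; have t10 : 0 < t + 1 by rewrite ltr_wpDl.
have /cvgrPdist_lt /(_ e e0) [N _ HN] := comparison_iter phi_comparison t10.
exists N => m /HN /=.
rewrite sub0r normrN ger0_norm ?iter_comparison_ge0 ?(ltW t10)//.
by apply: le_lt_trans; apply: iter_comparison_mono => //; rewrite lerDl.
Qed.

(** If [t < phi t], monotonicity keeps every iterate of [phi t] above [phi t > 0], so the iterates
    cannot tend to 0. *)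
Lemma comparison_le t : 0 <= t -> phi t <= t.
Proof.
move=> t0; rewrite leNgt; apply/negP => tphi.
have p0 : 0 < phi t by exact: le_lt_trans tphi.
have iter_ge m : phi t <= iter m phi (phi t).
  elim: m => //= m IHm; apply: (le_trans (y := phi (phi t))).
    by apply: comparison_mono => //; exact: ltW.
  by apply: comparison_mono => //; exact: ltW.
have [N /(_ N (leqnn N))] := iter_comparison_small (ltW p0) p0.
by rewrite ltNge iter_ge.
Qed.

End Comparison.

(** * Small balls and compact sets in a semimetric space *)

Section Semimetric.
Context {R : realType} {X : Type} {d : X -> X -> R}.
Context (d_semimetric : is_semimetric d).

Lemma semimetric_xx x : d x x = 0.
Proof. exact/(semimetric_eq0 d_semimetric). Qed.

Lemma triangle_bound {Phi : R * R -> R} :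
  triangle_function d (fun p => (Phi p)%:E) ->
  forall s t x y z, d x z <= s -> d z y <= t -> d x y <= Phi (s, t).
Proof.
move=> HPhi s t x y z xz zy; rewrite -lee_fin.
apply: (le_trans (triangle_ineq HPhi x y z)).
by apply: (triangle_mono HPhi); rewrite semimetric_ge0.
Qed.

(** Small-scale substitute for the triangle inequality; [Phi] itself serves only for large-scale
    bounds afterwards. *)
Definition triangle_small_ball :=
  forall e, 0 < e -> exists2 r, 0 < r &
    forall x y z, d x z < r -> d z y < r -> d x y < e.

Lemma usc_triangle_small_ball {Phi : R * R -> R} :
  triangle_function d (fun p => (Phi p)%:E) ->
  upper_semicontinuous_on (@nonneg_quadrant R) Phi -> triangle_small_ball.
Proof.
move=> HPhi usc e e0.
have Phi00 : Phi (0, 0) = 0 by have [] := triangle_0 HPhi.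
have := usc (0, 0); rewrite Phi00 => /(_ (conj (lexx _) (lexx _)) e e0).
rewrite near_withinE -filter_from_ballE => -[r /= r0 rP].
(* Halving puts the corner [(r / 2, r / 2)], where [Phi] is evaluated, strictly inside the ball of
   radius [r]. *)
exists (r / 2) => [|x y z xz zy]; first by rewrite divr_gt0.
have r20 : 0 < r / 2 by rewrite divr_gt0.
apply: (le_lt_trans (triangle_bound HPhi (ltW xz) (ltW zy))).
apply: rP; last by split; exact: ltW.
have rr : r / 2 < r by rewrite ltr_pdivrMr// ltr_pMr// ltr1n.
by split; rewrite /ball/= sub0r normrN gtr0_norm.
Qed.

Section SmallBall.
Context (d_small : triangle_small_ball).
Implicit Types (A : set X).

(* Balls need not be open; the open sets below are their interiors. *)
Lemma compact_finite_net A e : compact_sets d A -> 0 < e ->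
  exists2 D : {fset (semimetric_space d)}, (forall a, a \in D -> A a) &
    forall x, A x -> exists2 a, a \in D & d x a < e.
Proof.
move=> [_ Ac] e0.
pose f (p : semimetric_space d) : set (semimetric_space d) :=
  [set x | exists2 r, 0 < r & forall y, d y x < r -> d y p < e].
have fo p : A p -> open (f p).
  move=> _; apply/semimetric_openE => x [r r0 rP].
  (* Each [y] within [s] of [x] has its own [s]-ball inside the [r]-ball of [x], so [y] lies in
     [f p] too. *)
  have [s s0 sP] := d_small r0; exists s%:E; first by rewrite lte_fin.
  move=> y; rewrite /sball/= lte_fin => yx; exists s => // z zy.
  by apply: rP; exact: sP yx.
have Af : A `<=` cover A f.
  by move=> p Ap; exists p => //; exists e.
have [D DA AD] := Ac (semimetric_space d) A f fo Af.
exists D => [a /DA /set_mem //|x /AD [a aD [r r0]]].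
by move=> /(_ x); rewrite semimetric_xx => /(_ r0) ?; exists a.
Qed.

Lemma compact_semimetric_bounded {Phi : R * R -> R} A x0 :
  triangle_function d (fun p => (Phi p)%:E) -> compact_sets d A ->
  exists2 M, 0 <= M & forall x, A x -> d x0 x <= M.
Proof.
move=> HPhi Ac; have [D _ DP] := compact_finite_net Ac ltr01.
exists (\big[Order.max/0]_(a <- D) Phi (d x0 a, 1)) => [|x /DP [a aD xa]].
  exact: bigmax_ge_id.
apply: le_trans (le_bigmax_seq _ _ _ _ aD isT).
by apply: (triangle_bound HPhi) => //; rewrite semimetric_sym// ltW.
Qed.

End SmallBall.
End Semimetric.

Arguments triangle_small_ball {R X} d.

(** * Compositions of maps along words *)

Section Words.
Context {X : Type} {n : nat}.
Implicit Types (S : 'I_n -> X -> X) (w : seq 'I_n) (F : set X).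

Definition word_map S w x : X := foldr S x w.

Lemma word_map_cat S u v x :
  word_map S (u ++ v) x = word_map S u (word_map S v x).
Proof. exact: foldr_cat. Qed.

Lemma fractal_word_map S F w x : fractal S F -> F x -> F (word_map S w x).
Proof.
move=> [_ FE] Fx; elim: w => //= j w IHw.
by rewrite FE; exists j => //; exists (word_map S w x).
Qed.

(** Unfolds the fixed-point equation [m] times. Along long words contraction makes the choice of
    base point nearly irrelevant. *)
Lemma fractal_word_preimage S F m x : fractal S F -> F x ->
  exists w y, [/\ size w = m, F y & x = word_map S w y].
Proof.
move=> Ff; have [_ FE] := Ff.
elim: m x => [|m IHm] x Fx; first by exists [::], x.
move: Fx; rewrite {1}FE => -[j _ [y Fy <-]].
have [w [z [wm Fz ->]]] := IHm y Fy.
by exists (j :: w), z; rewrite /= wm.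
Qed.

Lemma word_map_contraction {R : realType} {d : X -> X -> R} {phi : R -> R} S w x y :
  is_semimetric d -> comparison_function phi ->
  (forall j, phi_contraction d phi (S j)) ->
  d (word_map S w x) (word_map S w y) <= iter (size w) phi (d x y).
Proof.
move=> d_semimetric phi_comparison Sc; elim: w => //= j w IHw.
apply: le_trans (Sc _ _ _) _.
by apply: comparison_mono => //; exact: semimetric_ge0.
Qed.

End Words.

(** * Stability of fractals under pointwise convergence *)

Section FractalStability.
Context {R : realType} {X : Type} {d : X -> X -> R}.
Context (d_semimetric : is_semimetric d).
Context {Phi : R * R -> R}.
Context (Phi_triangle : triangle_function d (fun p => (Phi p)%:E)).
Context (d_small : triangle_small_ball d).
Context {phi : R -> R} (phi_comparison : comparison_function phi).
Context {n : nat} {T : nat -> 'I_n -> X -> X}.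
Context (T_contraction : forall k j, phi_contraction d phi (T k j)).
Context (T_cvg : forall j x, d (T k j x) (T 0%N j x) @[k --> \oo] --> (0 : R)).

Let dsym := semimetric_sym d_semimetric.
Let d0 := semimetric_ge0 d_semimetric.

Lemma contraction_nonexpansive k j x y : d (T k j x) (T k j y) <= d x y.
Proof.
exact: le_trans (T_contraction _ _ _ _) (comparison_le phi_comparison (d0 _ _)).
Qed.

(** Nonexpansiveness spreads convergence from a finite net to all of [K], along the chain [T k j x],
    [T k j a], [T 0 j a], [T 0 j x]; its three legs take two uses of [d_small]. *)
Lemma compact_cvg_uniform K j e : compact_sets d K -> 0 < e ->
  \forall k \near \oo, forall x, K x -> d (T k j x) (T 0%N j x) < e.
Proof.
move=> Kc e0; have [r r0 rP] := d_small e0; have [s s0 sP] := d_small r0.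
pose q := Order.min r s; have q0 : 0 < q by rewrite lt_min r0.
have [D _ DP] := compact_finite_net d_semimetric d_small Kc q0.
have : \forall k \near \oo, forall a, a \in D -> d (T k j a) (T 0%N j a) < s.
  apply: (@filterS _ _ _ (\bigcap_(a in [set` D])
    [set k | d (T k j a) (T 0%N j a) < s])) => [k kP a aD|]; first exact: kP.
  apply: filter_bigI => a _.
  have /cvgrPdist_lt /(_ s s0) := T_cvg j a; apply: filterS => k.
  by rewrite sub0r normrN ger0_norm.
apply: filterS => k kP x /DP [a /kP aD]; rewrite lt_min => /andP[xar xas].
apply: (rP _ _ (T k j a)); first exact: le_lt_trans (contraction_nonexpansive _ _ _ _) _.
apply: sP aD _; rewrite dsym.
exact: le_lt_trans (contraction_nonexpansive _ _ _ _) _.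
Qed.

Context {K : set X} (K_compact : compact_sets d K) (K_fractal : fractal (T 0%N) K).

(** Induction on the word: [T 0] keeps the inner point in [K], where one-letter convergence is
    uniform, and the outer [T k j] does not enlarge the inner error. *)
Lemma word_map_cvg_uniform m e : 0 < e ->
  \forall k \near \oo, forall w x, size w = m -> K x ->
    d (word_map (T k) w x) (word_map (T 0%N) w x) < e.
Proof.
elim: m e => [|m IHm] e e0.
  by apply: nearW => k w x /size0nil -> _; rewrite /= semimetric_xx.
have [r r0 rP] := d_small e0.
have Tr : \forall k \near \oo, forall j x, K x -> d (T k j x) (T 0%N j x) < r.
  by apply: filter_forall => j; exact: compact_cvg_uniform.
apply: filterS2 (IHm r r0) Tr => k IHk Trk [//|j w] x [wm] Kx /=.
apply: (rP _ _ (T k j (word_map (T 0%N) w x))).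
  exact: le_lt_trans (contraction_nonexpansive _ _ _ _) (IHk _ _ wm Kx).
by apply: Trk; exact: fractal_word_map.
Qed.

Lemma orbit_near_fractal e : 0 < e -> exists2 m, (0 < m)%N &
  \forall k \near \oo, forall i w x, size w = (m * i)%N -> K x ->
    exists2 a, K a & d (word_map (T k) w x) a < e.
Proof.
(* Capping at 1 lets the induction hypothesis feed the estimate on iterates of [phi] at 1. *)
move=> e0; pose q := Order.min e 1; have q0 : 0 < q by rewrite lt_min e0/=.
have [r r0 rP] := d_small q0.
have [N NP] := iter_comparison_small phi_comparison ler01 r0.
(* The block length is a successor so that its multiples become arbitrarily large. *)
exists N.+1 => //; apply: filterS (word_map_cvg_uniform N.+1 r0) => k kP i w x.
move=> wm Kx; suff [a Ka] : exists2 a, K a & d (word_map (T k) w x) a < q.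
  by rewrite lt_min => /andP[ae _]; exists a.
elim: i w wm => [|i IHi] w wm.
  by move: wm; rewrite muln0 => /size0nil ->; exists x; rewrite //= semimetric_xx.
have wu : size (take N.+1 w) = N.+1 by rewrite size_takel// wm leq_pmulr.
have wv : size (drop N.+1 w) = (N.+1 * i)%N by rewrite size_drop wm mulnS addKn.
have [a Ka] := IHi _ wv.
rewrite -{2}(cat_take_drop N.+1 w) word_map_cat lt_min => /andP[_ ya].
(* With [u] the first block, [T k] along [u] brings the orbit point close to the image of [a], which
   is close to the image of [a] under [T 0] along [u]. *)
exists (word_map (T 0%N) (take N.+1 w) a); first exact: fractal_word_map.
apply: (rP _ _ (word_map (T k) (take N.+1 w) a)); last exact: kP.
apply: (le_lt_trans (word_map_contraction _ _ _ d_semimetric phi_comparison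
  (T_contraction k))).
rewrite wu; apply: le_lt_trans (NP N.+1 _) => //.
by apply: iter_comparison_mono => //; exact: ltW.
Qed.

Context {H : nat -> set X} (H_compact : forall k, compact_sets d (H k)).
Context (H_fractal : forall k, fractal (T k) (H k)).

Lemma fractals_near_limit e : 0 < e ->
  \forall k \near \oo, forall h, H k h -> exists2 a, K a & d h a < e.
Proof.
move=> e0; have [r r0 rP] := d_small e0.
have [[x0 Kx0] _] := K_compact.
have [m m0] := orbit_near_fractal r0; apply: filterS => k kP h Hh.
(* [M], hence [N], depends on [k]; this is harmless because [kP] holds for all multiples of [m] at
   once. *)
have [M M0 MP] :=
  compact_semimetric_bounded d_semimetric d_small x0 Phi_triangle (H_compact k).
have [N NP] := iter_comparison_small phi_comparison M0 r0.
have [w [y [wm Hy ->]]] := fractal_word_preimage (m * N) (H_fractal k) Hh.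
have [a Ka xa] := kP _ _ _ wm Kx0.
exists a => //; apply: rP xa.
apply: (le_lt_trans (word_map_contraction _ _ _ d_semimetric phi_comparison
  (T_contraction k))).
apply: le_lt_trans (NP (size w) _); last by rewrite wm leq_pmull.
by apply: iter_comparison_mono => //; rewrite dsym; exact: MP.
Qed.

Lemma limit_near_fractals e : 0 < e ->
  \forall k \near \oo, forall a, K a -> exists2 h, H k h & d a h < e.
Proof.
move=> e0; have [r r0 rP] := d_small e0.
have [[x0 Kx0] _] := K_compact.
have [M M0 MP] :=
  compact_semimetric_bounded d_semimetric d_small x0 Phi_triangle K_compact.
(* Bounds the chain from [K] to [x0], back to [K], then to a point within 1 of [K]. It does not
   involve [k], so [N] can be fixed before [k]. *)
pose M' := Phi (M, Phi (M, 1)).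
have M'P b a' h : K b -> K a' -> d h a' < 1 -> d b h <= M'.
  move=> Kb Ka' ha'; apply: (triangle_bound d_semimetric Phi_triangle (z := x0)).
    by rewrite dsym; exact: MP.
  apply: (triangle_bound d_semimetric Phi_triangle (z := a')); first exact: MP.
  by rewrite dsym ltW.
have M'0 : 0 <= M'.
  by apply: le_trans (d0 x0 x0) (M'P x0 x0 x0 Kx0 Kx0 _); rewrite semimetric_xx.
have [N NP] := iter_comparison_small phi_comparison M'0 r0.
apply: filterS2 (fractals_near_limit ltr01) (word_map_cvg_uniform N r0).
move=> k HK TT a Ka.
have [w [b [wN Kb ->]]] := fractal_word_preimage N K_fractal Ka.
have [[h Hh] _] := H_compact k; have [a' Ka' ha'] := HK _ Hh.
exists (word_map (T k) w h); first exact: fractal_word_map.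
apply: (rP _ _ (word_map (T k) w b)); first by rewrite dsym; exact: TT.
apply: (le_lt_trans (word_map_contraction _ _ _ d_semimetric phi_comparison
  (T_contraction k))).
rewrite wN; apply: le_lt_trans (NP N _) => //.
by apply: iter_comparison_mono => //; exact: M'P ha'.
Qed.

End FractalStability.

Lemma hausdorff_pompeiu_ge0 {R : realType} {X : Type} (d : X -> X -> R) A B :
  (0 <= hausdorff_pompeiu d A B)%E.
Proof. by apply: le_ereal_inf_tmp => e [/ltW]. Qed.

Lemma hausdorff_pompeiu_le {R : realType} {X : Type} (d : X -> X -> R) A B (e : R) :
  0 < e ->
  (forall a, A a -> exists2 b, B b & d a b < e) ->
  (forall b, B b -> exists2 a, A a & d b a < e) ->
  (hausdorff_pompeiu d A B <= e%:E)%E.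
Proof.
move=> e0 AB BA; apply: ereal_inf_lbound; split; first by rewrite lte_fin.
by split=> [x /AB|x /BA] [y ? ?]; exists y => //; rewrite /sball/= lte_fin.
Qed.

Theorem theorem16 (R : realType) (X : Type) (d : X -> X -> R)
  (d_semimetric : is_semimetric d)
  (d_complete : complete_semimetric d)
  (d_regular : regular_semimetric d)
  (Phi : R * R -> R)
  (Phi_triangle : triangle_function d (fun p => (Phi p)%:E))
  (Phi_usc : upper_semicontinuous_on (@nonneg_quadrant R) Phi)
  (phi : R -> R)
  (phi_comparison : comparison_function phi)
  (phi_usc : upper_semicontinuous_on (@nonneg_line R) phi)
  (n : nat) (T : nat -> 'I_n -> X -> X)
  (T_contraction : forall k j, phi_contraction d phi (T k j))
  (T_cvg : forall j x, d (T k j x) (T 0%N j x) @[k --> \oo] --> (0 : R))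
  (H : nat -> set X)
  (H_compact : forall k, compact_sets d (H k))
  (H_fractal : forall k, fractal (T k) (H k)) :
  hausdorff_pompeiu d (H k) (H 0%N) @[k --> \oo] --> (0 : \bar R)%E.
Proof.
have d_small := usc_triangle_small_ball d_semimetric Phi_triangle Phi_usc.
have D_le e : 0 < e ->
    \forall k \near \oo, (hausdorff_pompeiu d (H k) (H 0%N) <= e%:E)%E.
  move=> e0; apply: filterS2
    (fractals_near_limit d_semimetric Phi_triangle d_small phi_comparison
      T_contraction T_cvg (H_compact 0%N) (H_fractal 0%N) H_compact H_fractal e0)
    (limit_near_fractals d_semimetric Phi_triangle d_small phi_comparison
      T_contraction T_cvg (H_compact 0%N) (H_fractal 0%N) H_compact H_fractal e0).
  by move=> k HK KH; exact: hausdorff_pompeiu_le.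
(* The distance is a priori extended: it is first shown to be eventually finite, using the bound 1,
   and then to converge in [R]. *)
apply/fine_cvgP; split.
  apply: filterS (D_le 1 ltr01) => k Dk.
  by rewrite ge0_fin_numE ?hausdorff_pompeiu_ge0// (le_lt_trans Dk)// ltry.
apply/cvgrPdist_le => e e0; apply: filterS (D_le e e0) => k Dk.
rewrite /= sub0r normrN ger0_norm ?fine_ge0 ?hausdorff_pompeiu_ge0//.
rewrite -lee_fin fineK// ge0_fin_numE ?hausdorff_pompeiu_ge0//.
by rewrite (le_lt_trans Dk)// ltry.
Qed.
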